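(* Let $(\Xi_n)_{n\ge 0}$ be a sequence of vectors in $\mathbb{R}^N$ and let $(K_{ij})_{i,j\ge 0}$ be a family of real $N\times N$ matrices. Let the vectors $X_n\in\mathbb{R}^N$, $n\ge 0$, be defined recursively by $$X_n=\Xi_n+\sum_{l=0}^{n-1}\sum_{i=0}^{n-l-1}\frac{1}{n-i}\,K_{i,n-i-l-1}\,X_l ,\qquad n\ge 0,$$ and let $$L_0:=0,\qquad L_n:=\sum_{i=0}^{n-1}\|K_{i,n-i-1}\|\quad (n\ge 1).$$ If each of the power series $\sum_{n\ge0}t^n\Xi_n$ and $\sum_{n\ge 0}t^nL_n$ has a strictly positive radius of convergence, then the power series $\sum_{n=0}^{\infty}t^nX_n$ has a strictly positive radius of convergence.
   Context: $\|\cdot\|$ denotes a fixed vector norm on $\mathbb{R}^N$ and also the induced matrix norm on $N\times N$ matrices. Sums over empty index sets are $0$ (so $X_0=\Xi_0$). The recursion arises from substituting $x(t)=\sum t^iX_i$, $\xi(t)=\sum t^i\Xi_i$, $k(t,s)=\sum_{i,j} t^is^jK_{ij}$ into the linear Volterra system $x(t)=\xi(t)+\int_0^t k(t,s)x(s)\,ds$. *)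

(* Defs.v *)
From mathcomp Require Import all_boot all_order all_algebra.
From mathcomp Require Import all_classical all_reals all_analysis.
Import Order.TTheory GRing.Theory Num.Theory.
Import numFieldNormedType.Exports.

Set Implicit Arguments.
Unset Strict Implicit.
Unset Printing Implicit Defensive.

Local Open Scope classical_set_scope.
Local Open Scope ring_scope.

(* An arbitrary norm, unbundled: the canonical norm `|_| on column vectors is
   the max-norm. *)
Record is_vnorm (R : realType) (V : lmodType R) (nu : V -> R) : Prop := IsVNorm {
  vnorm_triangle : forall u v, nu (u + v) <= nu u + nu v;
  vnormZ : forall (a : R) v, nu (a *: v) = `|a| * nu v;
  vnorm_eq0 : forall v, nu v = 0 -> v = 0
}.

(* [sup] is real-valued and would be 0 on an unbounded set, but the set below
   is bounded when nu is a norm, the dimension being finite. *)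
Definition induced_mxnorm (R : realType) (N : nat) (nu : 'cV[R]_N -> R)
    (A : 'M[R]_N) : R :=
  sup [set nu (A *m v) | v in [set v | nu v <= 1]].

(* Convergence is for the canonical topology of V; on column vectors this is
   the topology induced by any norm. The value t = 0 always contributes, so
   the radius is at least 0. *)
Definition convergence_radius (R : realType) (V : normedModType R)
    (a : nat -> V) : \bar R :=
  ereal_sup [set `|t|%:E | t in
    [set t : R | cvgn (series (fun n => t ^+ n *: a n))]].

Definition kernel_norm_seq (R : realType) (N : nat) (nu : 'cV[R]_N -> R)
    (K : nat -> nat -> 'M[R]_N) (n : nat) : R :=
  \sum_(0 <= i < n) induced_mxnorm nu (K i (n - i - 1)%N).

(* Main.v *)
From HB Require Import structures.
Require Import Defs.
From mathcomp Require Import all_boot all_order all_algebra.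
From mathcomp Require Import all_classical all_reals all_analysis.
From mathcomp Require Import ring.
Import Order.TTheory GRing.Theory Num.Theory.
Import numFieldNormedType.Exports.

Local Open Scope ring_scope.

(** A power series has a positive radius of convergence iff its coefficients
    grow at most geometrically. Since 1 / (n - i) <= 1 in the recursion and all
    norms on R^N are equivalent, x_n := nu (X_n) satisfies
    x_n <= nu (Xi_n) + \sum_(l < n) L_(n - l) x_l; when nu (Xi_n) and L_n are both
    at most M r^n, induction gives x_n <= M (r (1 + M))^n, because
    1 + \sum_(l < n) M (1 + M)^l = (1 + M)^n. *)

(* Provides the missing join 'M[R]_(m, n) : completeNormedModType R. *)
HB.instance Definition _ (R : realType) (m n : nat) :=
  NormedModule.on 'M[R]_(m, n).

Section VectorNorm.
Context {R : realType} {V : lmodType R} {nu : V -> R}.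
Hypothesis nu_norm : is_vnorm nu.

Lemma vnorm0 : nu 0 = 0.
Proof. by rewrite -(scale0r (0 : V)) (vnormZ nu_norm) normr0 mul0r. Qed.

Lemma vnormN v : nu (- v) = nu v.
Proof. by rewrite -scaleN1r (vnormZ nu_norm) normrN1 mul1r. Qed.

(** Nonnegativity follows from the axioms: [0 = nu (v - v) <= 2 * nu v]. *)
Lemma vnorm_ge0 v : 0 <= nu v.
Proof.
have := vnorm_triangle nu_norm v (- v).
by rewrite subrr vnorm0 vnormN -mulr2n pmulrn_lge0.
Qed.

Lemma vnorm_sum (I : Type) (r : seq I) (P : pred I) (F : I -> V) :
  nu (\sum_(i <- r | P i) F i) <= \sum_(i <- r | P i) nu (F i).
Proof.
elim/big_ind2 : _ => //; first by rewrite vnorm0.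
move=> u a v b ua vb; apply: le_trans (vnorm_triangle nu_norm _ _) _.
exact: lerD.
Qed.

Lemma vnorm_dist u v : `|nu u - nu v| <= nu (u - v).
Proof.
have H a b : nu a - nu b <= nu (a - b).
  by rewrite lerBlDr; have := vnorm_triangle nu_norm (a - b) b; rewrite subrK.
by rewrite ler_norml H andbT lerNl opprB -(vnormN (u - v)) opprB H.
Qed.

End VectorNorm.

(** * Equivalence of norms in finite dimension, and the induced matrix norm *)

Section MatrixSpaceNorm.
Context {R : realType}.

Lemma normr_trmx m n (A : 'M[R]_(m, n)) : `|A^T| = `|A|.
Proof.
have H p q (B : 'M[R]_(p, q)) : `|B^T| <= `|B|.
  rewrite {1}/Num.norm/= mx_normrE.
  apply: bigmax_le => // -[i j] _ /=; rewrite mxE.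
  rewrite {2}/Num.norm/= mx_normrE.
  exact: (le_bigmax _ (fun ij : 'I_p * 'I_q => `|B ij.1 ij.2|) (j, i)).
by apply/eqP; rewrite eq_le H -{1}(trmxK A) H.
Qed.

Lemma normr_mx_coord m n (A : 'M[R]_(m, n)) i j : `|A i j| <= `|A|.
Proof.
rewrite {2}/Num.norm/= mx_normrE.
exact: (le_bigmax _ (fun ij : 'I_m * 'I_n => `|A ij.1 ij.2|) (i, j)).
Qed.

(** Expand [A] in the matrix units: each coordinate is at most the max-norm, so the sum of the
    [nu (delta_mx i j)] serves as constant. *)
Lemma vnorm_le_normr m n (nu : 'M[R]_(m, n) -> R) : is_vnorm nu ->
  exists2 C, 0 < C & forall A, nu A <= C * `|A|.
Proof.
move=> nu_norm.
pose S := \sum_i \sum_j nu (delta_mx i j).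
have S0 : 0 <= S.
  by apply: sumr_ge0 => i _; apply: sumr_ge0 => j _; exact: vnorm_ge0.
(* Adding 1 keeps the constant positive when the matrices are empty and [S = 0]. *)
exists (S + 1) => [|A]; first exact: ltr_wpDl.
apply: (@le_trans _ _ (S * `|A|)); last by rewrite ler_wpM2r// lerDl.
rewrite {1}(matrix_sum_delta A) mulr_suml.
apply: le_trans (vnorm_sum nu_norm _ _ _ _) _; apply: ler_sum => i _.
rewrite mulr_suml; apply: le_trans (vnorm_sum nu_norm _ _ _ _) _.
apply: ler_sum => j _; rewrite (vnormZ nu_norm) mulrC.
by rewrite ler_wpM2l ?normr_mx_coord ?vnorm_ge0.
Qed.

Lemma vnorm_continuous m n (nu : 'M[R]_(m, n) -> R) :
  is_vnorm nu -> continuous nu.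
Proof.
move=> nu_norm A; have [C C0 nuC] := vnorm_le_normr m n nu nu_norm.
apply/(@cvgrPdist_lt _ _ _ _ (nbhs_filter A)) => e e0.
have : \forall B \near A, ball A (e / C) B.
  by apply: nbhsx_ballx; exact: divr_gt0.
apply: filterS => B; rewrite -ball_normE /= ltr_pdivlMr// mulrC.
by apply: le_lt_trans; apply: le_trans (vnorm_dist nu_norm _ _) _.
Qed.

(** By compactness [nu] attains a minimum on the max-norm unit sphere. Definiteness makes it
    positive, and homogeneity carries the bound to every [v]; the constant is the inverse of the
    minimum. *)
Lemma normr_le_vnorm_row n (nu : 'rV[R]_n -> R) : is_vnorm nu ->
  exists2 c, 0 < c & forall v, `|v| <= c * nu v.
Proof.
move=> nu_norm.
pose S := [set v : 'rV[R]_n | `|v| = 1]%classic.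
have unitS v : v != 0 -> S (`|v|^-1 *: v).
  by move=> v0; rewrite /S/= normrZ normfV normr_id mulVf ?normr_eq0.
(* If the sphere is empty, then every vector is 0 and any constant works. *)
have [S0|/set0P/negP/negPn/eqP S0] := pselect (S !=set0)%classic; last first.
  exists 1 => // v; have [->|v0] := eqVneq v 0.
    by rewrite normr0 mul1r vnorm_ge0.
  by have := unitS v v0; rewrite S0.
have cS : compact S.
  apply: bounded_closed_compact.
    exists 1; split => [|x x1 v /= ->]; [exact: num_real|exact: ltW].
  rewrite (_ : S = Num.norm @^-1` [set x | x = 1])%classic//.
  move/continuous_closedP: (@norm_continuous R 'rV[R]_n); apply.
  exact: closed_eq.
have [c /set_mem cin cmin] :=
  EVT_min_rV S0 cS (continuous_subspaceT (vnorm_continuous _ _ _ nu_norm)).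
have nuc0 : 0 < nu c.
  rewrite lt_neqAle vnorm_ge0// andbT eq_sym.
  apply/eqP => /(vnorm_eq0 nu_norm) c0.
  by move: cin; rewrite /S/= c0 normr0 => /esym/eqP; rewrite oner_eq0.
exists (nu c)^-1 => [|v]; first by rewrite invr_gt0.
have [->|v0] := eqVneq v 0; first by rewrite normr0 (vnorm0 nu_norm) mulr0.
have := cmin _ (mem_set (unitS v v0)); rewrite (vnormZ nu_norm) normfV normr_id.
by rewrite mulrC ler_pdivlMr ?normr_gt0// mulrC -ler_pdivlMr// mulrC.
Qed.

Lemma normr_le_vnorm_col n (nu : 'cV[R]_n -> R) : is_vnorm nu ->
  exists2 c, 0 < c & forall v, `|v| <= c * nu v.
Proof.
move=> nu_norm.
have nuT : is_vnorm (fun v : 'rV[R]_n => nu v^T).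
  split => [u v|a v|v]; first by rewrite linearD/= (vnorm_triangle nu_norm).
  - by rewrite linearZ/= (vnormZ nu_norm).
  - by move/(vnorm_eq0 nu_norm)/(congr1 trmx); rewrite trmxK trmx0.
have [c c0 cnu] := normr_le_vnorm_row n _ nuT.
by exists c => // v; have := cnu v^T; rewrite normr_trmx trmxK.
Qed.

Lemma normr_mulmx_le m n p (A : 'M[R]_(m, n)) :
  exists2 C, 0 <= C & forall B : 'M[R]_(n, p), `|A *m B| <= C * `|B|.
Proof.
exists (n%:R * `|A|) => [|B]; first exact: mulr_ge0.
rewrite {1}/Num.norm/= mx_normrE.
apply: bigmax_le => [|[i j] _ /=]; first by rewrite !mulr_ge0.
rewrite mxE; apply: le_trans (ler_norm_sum _ _ _) _.
apply: (@le_trans _ _ (\sum_(k < n) `|A| * `|B|)).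
  by apply: ler_sum => k _; rewrite normrM ler_pM// normr_mx_coord.
by rewrite sumr_const card_ord -mulrA mulr_natl.
Qed.

(** Ensures that the [sup] in [induced_mxnorm] is a genuine supremum and not the default 0. The
    bound passes from [nu] to the max-norm and back. *)
Lemma induced_mxnorm_ub n (nu : 'cV[R]_n -> R) (A : 'M[R]_n) : is_vnorm nu ->
  has_ubound [set nu (A *m v) | v in [set v | nu v <= 1]]%classic.
Proof.
move=> nu_norm.
have [C C0 nuC] := vnorm_le_normr _ _ nu nu_norm.
have [c c0 cnu] := normr_le_vnorm_col _ nu nu_norm.
have [D D0 AD] := normr_mulmx_le _ _ 1 A.
exists (C * (D * c)) => _ [v /= v1 <-].
apply: le_trans (nuC _) _; rewrite ler_pM2l//.
apply: le_trans (AD _) _; rewrite ler_wpM2l//.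
by apply: le_trans (cnu _) _; rewrite -[leRHS]mulr1 ler_pM2l.
Qed.

Lemma induced_mxnorm_ge0 n (nu : 'cV[R]_n -> R) (A : 'M[R]_n) : is_vnorm nu ->
  0 <= induced_mxnorm nu A.
Proof.
move=> nu_norm; apply: ub_le_sup; first exact: induced_mxnorm_ub.
by exists 0; rewrite /= ?mulmx0 vnorm0.
Qed.

Lemma vnorm_mulmx n (nu : 'cV[R]_n -> R) (A : 'M[R]_n) v : is_vnorm nu ->
  nu (A *m v) <= induced_mxnorm nu A * nu v.
Proof.
move=> nu_norm.
have [nuv0|nuv0] := eqVneq (nu v) 0.
  by rewrite (vnorm_eq0 nu_norm nuv0) mulmx0 vnorm0// mulr0.
have nuv : 0 < nu v by rewrite lt_neqAle eq_sym nuv0 vnorm_ge0.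
rewrite -ler_pdivrMr//; apply: ub_le_sup; first exact: induced_mxnorm_ub.
have nuVv : `|(nu v)^-1| = (nu v)^-1 by rewrite ger0_norm// invr_ge0 ltW.
(* Normalising [v] gives a point of the unit ball whose image has norm [nu (A *m v) / nu v]. *)
exists ((nu v)^-1 *: v); rewrite /= ?(vnormZ nu_norm) ?nuVv ?mulVf//.
by rewrite -scalemxAr (vnormZ nu_norm) nuVv mulrC.
Qed.

End MatrixSpaceNorm.

(** * Positive radius of convergence versus geometric growth *)

Section ConvergenceRadius.
Context {R : realType}.

(** At a nonzero [t] of convergence the terms tend to 0, hence are bounded; this gives growth rate
    [1 / |t|]. *)
Lemma convergence_radius_gt0_growth (V : normedModType R) (a : nat -> V) :
  (0 < convergence_radius a)%E ->
  exists M r, [/\ 0 <= M, 0 < r & forall n, `|a n| <= M * r ^+ n].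
Proof.
move=> /ereal_sup_gt[_ [t /= cvg_t <-]]; rewrite lte_fin => t0.
have /cvg_seq_bounded[M [_ bM]] : cvgn (fun n => t ^+ n *: a n).
  by apply/cvg_ex; exists 0; exact: cvg_series_cvg_0.
exists `|M + 1|, `|t|^-1; split => [//||n]; first by rewrite invr_gt0.
rewrite exprVn ler_pdivlMr ?exprn_gt0// mulrC -normrX -normrZ.
apply: le_trans (ler_norm (M + 1)).
by apply: bM => //; rewrite ltrDl.
Qed.

(** At [t = 1 / (2 * r)] the terms are dominated by [M / 2 ^ n], and completeness turns absolute
    convergence into convergence. *)
Lemma growth_convergence_radius_gt0 (V : completeNormedModType R)
    (a : nat -> V) (M r : R) :
  0 < r -> (forall n, `|a n| <= M * r ^+ n) -> (0 < convergence_radius a)%E.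
Proof.
move=> r0 ar; pose t := (2 * r)^-1.
have t0 : 0 < t by rewrite invr_gt0 mulr_gt0.
have M0 : 0 <= M by have := ar 0%N; rewrite expr0 mulr1; exact: le_trans.
apply: (@lt_le_trans _ _ `|t|%:E); first by rewrite lte_fin gtr0_norm.
apply: ereal_sup_ubound; exists t => //=.
apply: normed_cvg; apply: (@series_le_cvg _ _ (geometric M 2^-1)) => [n|n|n|].
- exact: normr_ge0.
- by rewrite /= mulr_ge0// exprn_ge0// invr_ge0.
- rewrite /= normrZ normrX gtr0_norm//.
  apply: le_trans (ler_wpM2l _ (ar n)) _; first by rewrite exprn_ge0 ?ltW.
  rewrite mulrCA -exprMn /t invfM -mulrA mulVf ?gt_eqF// mulr1.
  exact: lexx.
- by apply: is_cvg_geometric_series; rewrite gtr0_norm ?invr_gt0//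
    invf_lt1 ?ltr1n.
Qed.

End ConvergenceRadius.

(** * The scalar convolution inequality and the theorem *)

Lemma convolution_ineq_growth {R : realType} (x b L : nat -> R) (M r : R) :
  0 <= M -> 0 <= r ->
  (forall n, b n <= M * r ^+ n) -> (forall n, 0 <= L n <= M * r ^+ n) ->
  (forall n, x n <= b n + \sum_(0 <= l < n) L (n - l)%N * x l) ->
  forall n, x n <= M * (r * (1 + M)) ^+ n.
Proof.
move=> M0 r0 bM LM xL; elim/ltn_ind => n IHn.
have geom k : 1 + \sum_(0 <= l < k) M * (1 + M) ^+ l = (1 + M) ^+ k.
  elim: k => [|k IHk]; first by rewrite big_geq// addr0.
  by rewrite big_nat_recr//= addrA IHk exprS mulrDl mul1r.
apply: le_trans (xL n) _.
rewrite exprMn -geom mulrA mulrDr mulr1 lerD// mulr_sumr.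
rewrite !big_nat; apply: ler_sum => l /andP[_ ln].
have /andP[L0 LMl] := LM (n - l)%N.
apply: le_trans (ler_wpM2l L0 (IHn l ln)) _.
have B0 : 0 <= M * (r * (1 + M)) ^+ l.
  by rewrite mulr_ge0// exprn_ge0// mulr_ge0// addr_ge0.
(* Splitting [r ^+ n] as [r ^+ (n - l) * r ^+ l] pairs the bound on [L (n - l)] with the induction
   hypothesis at [l]. *)
have -> : M * r ^+ n * (M * (1 + M) ^+ l) =
    M * r ^+ (n - l) * (M * (r * (1 + M)) ^+ l).
  by rewrite -{1}(subnK (ltnW ln)) exprD exprMn; ring.
exact: ler_wpM2r.
Qed.

Theorem theorem3p1 (R : realType) (N : nat)
    (nu : 'cV[R]_N -> R) (nu_norm : is_vnorm nu)
    (Xi : nat -> 'cV[R]_N) (K : nat -> nat -> 'M[R]_N)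
    (X : nat -> 'cV[R]_N)
    (X_rec : forall n : nat,
       X n = Xi n + \sum_(0 <= l < n) \sum_(0 <= i < n - l)
               (n - i)%:R^-1 *: (K i (n - i - l - 1)%N *m X l)) :
  (0 < convergence_radius Xi)%E ->
  (0 < convergence_radius (kernel_norm_seq nu K : nat -> R^o))%E ->
  (0 < convergence_radius X)%E.
Proof.
move=> /convergence_radius_gt0_growth[M1 [r1 [M1_ge0 r1_gt0 XiM]]].
move=> /convergence_radius_gt0_growth[M2 [r2 [M2_ge0 r2_gt0 LM]]].
have [C C0 nuC] := vnorm_le_normr _ _ nu nu_norm.
have [c c0 cnu] := normr_le_vnorm_col _ nu nu_norm.
(* A common bound for both sequences; [C] converts max-norm growth of [Xi] into growth of
   [nu (Xi n)]. *)
pose M := C * M1 + M2; pose r := r1 + r2.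
have CM1_ge0 : 0 <= C * M1 by rewrite mulr_ge0// ltW.
have M_ge0 : 0 <= M by rewrite addr_ge0.
have r_gt0 : 0 < r by rewrite addr_gt0.
have nuX_rec n : nu (X n) <=
    nu (Xi n) + \sum_(0 <= l < n) kernel_norm_seq nu K (n - l) * nu (X l).
  rewrite {1}X_rec; apply: le_trans (vnorm_triangle nu_norm _ _) _.
  rewrite lerD2l; apply: le_trans (vnorm_sum nu_norm _ _ _ _) _.
  rewrite !big_nat; apply: ler_sum => l /andP[_ ln].
  rewrite mulr_suml; apply: le_trans (vnorm_sum nu_norm _ _ _ _) _.
  rewrite !big_nat; apply: ler_sum => i /andP[_ il].
  have in_ : (i < n)%N by apply: leq_trans il (leq_subr _ _).
  (* Swapping the subtractions turns the index of [K] into [n - l - i - 1], the one in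
     [kernel_norm_seq nu K (n - l)]. *)
  rewrite (vnormZ nu_norm) (subnAC n i l).
  apply: (le_trans _ (vnorm_mulmx _ _ _ _ nu_norm)).
  rewrite ler_piMl ?vnorm_ge0// ger0_norm ?invr_ge0//.
  by rewrite invf_le1 ?ler1n ?ltr0n subn_gt0.
have growth_le M' r' n : 0 <= M' <= M -> 0 < r' <= r ->
    M' * r' ^+ n <= M * r ^+ n.
  move=> /andP[M'0 M'M] /andP[r'0 r'r].
  apply: ler_pM => //; first by rewrite exprn_ge0 ?ltW.
  by apply: lerXn2r => //; rewrite nnegrE ltW.
have nuX_growth : forall n, nu (X n) <= M * (r * (1 + M)) ^+ n.
  apply: (@convolution_ineq_growth _ _ (nu \o Xi) (kernel_norm_seq nu K)) => //.
  - exact: ltW.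
  - move=> n; apply: le_trans (nuC _) _.
    apply: (@le_trans _ _ (C * M1 * r1 ^+ n)); first by rewrite -mulrA ler_pM2l.
    by apply: growth_le; rewrite ?CM1_ge0 ?r1_gt0 /= lerDl// ltW.
  - move=> n; apply/andP; split.
      by apply: sumr_ge0 => i _; exact: induced_mxnorm_ge0.
    apply: le_trans (le_trans (ler_norm _) (LM n)) _.
    by apply: growth_le; rewrite ?M2_ge0 ?r2_gt0 /= lerDr// ltW.
(* The radius is defined by the max-norm topology, so [c] brings the bound back from [nu]. *)
apply: (@growth_convergence_radius_gt0 _ _ _ (c * M) (r * (1 + M))).
  by rewrite mulr_gt0// ltr_pwDl.
move=> n; apply: le_trans (cnu _) _.
by rewrite -mulrA ler_pM2l.
Qed.
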